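(* Let $P>0$, $\sigma_n^2>0$, $\sigma_e^2\in(0,1)$ and $\xi\in(0,1)$, and let $\rho_d^*=\rho_d^*(|\hat h|^2)$ be the optimal adaptive policy of problem P2.1, given by the explicit formula in the context. Then: (i) $\rho_d^*(|\hat h|^2)=0$ for all sufficiently small $|\hat h|^2$; (ii) $\rho_d^*(|\hat h|^2)\to0$ as $|\hat h|^2\to\infty$; (iii) hence $\rho_d^*$ is not a monotonic function of $|\hat h|^2$.
   Context: Problem P2.1: let $\hat h$ be a zero-mean circularly symmetric complex Gaussian random variable with $\mathbb{E}\{|\hat h|^2\}=1-\sigma_e^2$. Over all measurable functions $\rho_d=\rho_d(|\hat h|^2)$ with values in $[0,1]$, maximize $$\mathbb{E}\Big\{\log\Big(1+\frac{\rho_dP|\hat h|^2}{\sigma_n^2+\rho_dP\sigma_e^2}\Big)\Big\}\quad\text{subject to}\quad \mathbb{E}\big\{(1-\rho_d)(|\hat h|^2+\sigma_e^2)\big\}=\xi .$$ Its optimal policy is the pointwise-defined function $$\rho_d^*=\begin{cases}0, & \rho_{d,r}<0,\\ \rho_{d,r}, & 0\le\rho_{d,r}\le1,\\ 1, & \rho_{d,r}>1,\end{cases}\qquad \rho_{d,r}=\frac{-(\nu+\sigma_e^2)+\sqrt{(\nu+\sigma_e^2)^2-4\sigma_e^2\nu\Big(1-\dfrac{P|\hat h|^2}{\sigma_n^2\,\nu\,\lambda^*}\Big)}}{2\sigma_e^2\,\nu\,P/\sigma_n^2},$$ with $\nu=|\hat h|^2+\sigma_e^2$, where $\lambda^*\in(0,P/\sigma_n^2)$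 is a constant independent of $|\hat h|^2$ such that the constraint $\mathbb{E}\{(1-\rho_d^* )(|\hat h|^2+\sigma_e^2)\}=\xi$ holds. *)

(* Defs.v *)
From HB Require Import structures.
From mathcomp Require Import all_boot all_order all_algebra.
From mathcomp Require Import complex.
From mathcomp Require Import all_classical all_reals all_analysis.

Set Implicit Arguments.
Unset Strict Implicit.
Unset Printing Implicit Defensive.

Import Order.TTheory GRing.Theory Num.Theory.
Import numFieldTopology.Exports numFieldNormedType.Exports.

Local Open Scope classical_set_scope.
Local Open Scope ring_scope.

(* [normal_prob m s] takes the standard deviation [s] and is not the point mass
   at [m] for [s = 0], so degenerate Gaussians are handled separately. *)
Definition gaussian (R : realType) (d : measure_display)
    (T : measurableType d) (Pr : probability T R) (X : T -> R) : Prop :=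
  exists m s : R, 0 <= s /\
    forall A : set R, measurable A ->
      Pr (X @^-1` A) = if s == 0 then \d_m A else normal_prob m s A.

Definition complex_gaussian (R : realType) (d : measure_display)
    (T : measurableType d) (Pr : probability T R) (h : T -> R[i]) : Prop :=
  [/\ measurable_fun setT (fun w => complex.Re (h w)),
      measurable_fun setT (fun w => complex.Im (h w)) &
      forall a b : R,
        gaussian Pr (fun w => a * complex.Re (h w) + b * complex.Im (h w))].

(* [c * h] has the same law on the plane as [h] for every unimodular [c]. *)
Definition circularly_symmetric (R : realType) (d : measure_display)
    (T : measurableType d) (Pr : probability T R) (h : T -> R[i]) : Prop :=
  forall c : R[i], `|c| = 1 ->
    forall A : set (R * R), measurable A ->
      Pr [set w | A (complex.Re (c * h w), complex.Im (c * h w))] =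
      Pr [set w | A (complex.Re (h w), complex.Im (h w))].

Definition zero_mean (R : realType) (d : measure_display)
    (T : measurableType d) (Pr : probability T R) (h : T -> R[i]) : Prop :=
  ('E_Pr[fun w => complex.Re (h w)] = 0%:E)%E /\
  ('E_Pr[fun w => complex.Im (h w)] = 0%:E)%E.

Definition sqmod (R : realType) (z : R[i]) : R := ComplexField.Normc.normc z ^+ 2.

Section problem_P21.
Variables (R : realType) (d : measure_display) (T : measurableType d).
Variables (Pr : probability T R) (h : T -> R[i]).
(* [sn2] is the noise variance, [se2] the estimation error variance. *)
Variables (P sn2 se2 xi : R).

(* A policy is a function of [|h|^2]; only its values on [0, +oo[ matter. *)
Definition policy (rho : R -> R) : Prop :=
  measurable_fun (`[0, +oo[%classic : set R) rho /\
  forall x, 0 <= x -> 0 <= rho x <= 1.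

(* Natural logarithm: the multiplier in the explicit policy below is scaled
   accordingly; another base only rescales the objective. *)
Definition rate (rho : R -> R) : \bar R :=
  ('E_Pr[fun w => ln (1 + rho (sqmod (h w)) * P * sqmod (h w) /
                         (sn2 + rho (sqmod (h w)) * P * se2))])%E.

Definition harvesting_constraint (rho : R -> R) : Prop :=
  ('E_Pr[fun w => ((1 - rho (sqmod (h w))) * (sqmod (h w) + se2))%R] = xi%:E)%E.

Definition optimal_policy (rho : R -> R) : Prop :=
  [/\ policy rho, harvesting_constraint rho &
      forall rho' : R -> R, policy rho' -> harvesting_constraint rho' ->
        (rate rho' <= rate rho)%E].

End problem_P21.

Section explicit_policy.
Variables (R : realType) (P sn2 se2 lambda : R).

(* With [a := P / sn2] and [nu := x + se2], [rho_r x] is the larger root [r] of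
   [(1 + r * a * nu) * (1 + r * a * se2) = a * x / (lambda * nu)], the stationarity
   condition in [r] of the Lagrangian of the problem above, with multiplier
   [lambda] for the constraint. *)
Definition rho_r (x : R) : R :=
  let nu := x + se2 in
  (- (nu + se2) +
   Num.sqrt ((nu + se2) ^+ 2 -
             4 * se2 * nu * (1 - P * x / (sn2 * nu * lambda)))) /
  (2 * se2 * nu * P / sn2).

Definition rho_star (x : R) : R :=
  if rho_r x < 0 then 0 else if rho_r x <= 1 then rho_r x else 1.

End explicit_policy.

(* Main.v *)
(* The radicand of [rho_r] is the quadratic [x^2 + 4 a se2 x / lambda] with
   [a := P / sn2].  Comparing it with [(x + 2 se2)^2] shows that the policy
   vanishes exactly for [x (a - lambda) <= se2 lambda]; completing the square
   shows that it is at most [1 / (lambda (x + se2))]. *)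
Require Import Defs.
From HB Require Import structures.
From mathcomp Require Import all_boot all_order all_algebra.
From mathcomp Require Import complex.
From mathcomp Require Import all_classical all_reals all_analysis.
From mathcomp Require Import ring lra.

Set Implicit Arguments.
Unset Strict Implicit.
Unset Printing Implicit Defensive.

Import Order.TTheory GRing.Theory Num.Theory.
Import numFieldTopology.Exports numFieldNormedType.Exports.

Local Open Scope classical_set_scope.
Local Open Scope ring_scope.

Section rho_star_bounds.
Variables (R : realType) (P sn2 se2 lambda : R).
Hypotheses (hP : 0 < P) (hsn2 : 0 < sn2) (hse2 : 0 < se2) (hlambda : 0 < lambda).

Let a_gt0 : 0 < P / sn2. Proof. exact: divr_gt0. Qed.

(** With [nu := x + se2], the terms of the radicand free of [lambda] form [(nu + se2) ^+ 2 - 4 * se2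
    * nu = (nu - se2) ^+ 2 = x ^+ 2], and [nu] cancels in the remaining one. *)
Lemma rho_rE (x : R) : 0 <= x ->
  rho_r P sn2 se2 lambda x =
  (Num.sqrt (x ^+ 2 + 4 * se2 * (P / sn2) / lambda * x) - (x + 2 * se2)) /
  (2 * se2 * (x + se2) * (P / sn2)).
Proof.
move=> x0; have nu0 : x + se2 != 0 by rewrite gt_eqF// ltr_wpDl.
rewrite /rho_r -(mulrA _ P); congr (_ / _).
by rewrite addrC; congr (Num.sqrt _ - _); [field; rewrite nu0 !gt_eqF|ring].
Qed.

Let den_gt0 (x : R) : 0 <= x -> 0 < 2 * se2 * (x + se2) * (P / sn2).
Proof. by move=> x0; rewrite !mulr_gt0// ?invr_gt0// ltr_wpDl. Qed.

Lemma rho_r_le0 (x : R) : 0 <= x ->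
  (rho_r P sn2 se2 lambda x <= 0) = (x * (P / sn2 - lambda) <= se2 * lambda).
Proof.
move=> x0; rewrite rho_rE// pmulr_lle0 ?invr_gt0 ?den_gt0// subr_le0.
have y0 : 0 <= x + 2 * se2 by rewrite addr_ge0// mulr_ge0// ltW.
have k0 : 0 <= x ^+ 2 + 4 * se2 * (P / sn2) / lambda * x.
  by rewrite addr_ge0 ?sqr_ge0// !mulr_ge0 ?invr_ge0// ltW.
rewrite -(ler_pXn2r (n := 2)) ?nnegrE ?sqrtr_ge0// sqr_sqrtr//.
rewrite -subr_le0 -[RHS]subr_le0.
(* The difference of the two squares is this positive factor times
   [x * (P / sn2 - lambda) - se2 * lambda]. *)
rewrite -[RHS](pmulr_rle0 _ (x := 4 * se2 / lambda)) ?divr_gt0 ?mulr_gt0//.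
by congr (_ <= 0); field; rewrite !gt_eqF.
Qed.

Lemma rho_r_le (x : R) : 0 <= x ->
  rho_r P sn2 se2 lambda x <= (lambda * (x + se2))^-1.
Proof.
move=> x0; rewrite rho_rE// ler_pdivrMr ?den_gt0//.
have nu0 : x + se2 != 0 by rewrite gt_eqF// ltr_wpDl.
(* [k] is both the claimed bound times the denominator and half the linear coefficient of the
   radicand, which is thus [(x + k) ^+ 2 - k ^+ 2]. *)
set k := 2 * se2 * (P / sn2) / lambda.
have k0 : 0 < k by rewrite divr_gt0// !mulr_gt0 ?invr_gt0.
have -> : (lambda * (x + se2))^-1 * (2 * se2 * (x + se2) * (P / sn2)) = k.
  by rewrite /k; field; rewrite nu0 !gt_eqF.
have -> : 4 * se2 * (P / sn2) / lambda = 2 * k.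
  by rewrite /k; field; rewrite !gt_eqF.
have xk0 : 0 <= x + k by rewrite addr_ge0// ltW.
have sqrt_le : Num.sqrt (x ^+ 2 + 2 * k * x) <= x + k.
  by rewrite -[leRHS]ger0_norm// -sqrtr_sqr ler_sqrt ?sqr_ge0//; nra.
by rewrite lerBlDr (le_trans sqrt_le)// addrC addrA lerDl mulr_ge0// ltW.
Qed.

Lemma rho_star_ge0 (x : R) : 0 <= rho_star P sn2 se2 lambda x.
Proof.
by rewrite /rho_star; case: ltP => // r0; case: ifP => // _; exact: ler01.
Qed.

Lemma rho_star_eq0 (x : R) : 0 <= x ->
  (rho_star P sn2 se2 lambda x == 0) = (x * (P / sn2 - lambda) <= se2 * lambda).
Proof.
move=> x0; rewrite -rho_r_le0// /rho_star.
case: ltP => [/ltW ->|r0]; first exact: eqxx.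
case: leP => [_|r1]; first by rewrite eq_le r0 andbT.
by rewrite oner_eq0 leNgt (lt_trans ltr01).
Qed.

(** Clipping preserves the bound on [rho_r]: the bound is nonnegative, and the value 1 is taken only
    where [rho_r] exceeds it. *)
Lemma rho_star_le (x : R) : 0 <= x ->
  rho_star P sn2 se2 lambda x <= (lambda * (x + se2))^-1.
Proof.
move=> x0; rewrite /rho_star; case: ltP => _.
  by rewrite invr_ge0 mulr_ge0 ?addr_ge0// ltW.
case: (leP _ 1) => [_|/ltW r1]; first exact: rho_r_le.
exact: le_trans r1 (rho_r_le x0).
Qed.

Lemma rho_star_cvg0 : rho_star P sn2 se2 lambda x @[x --> +oo] --> (0 : R).
Proof.
apply/cvgrPdist_le => e e0; near=> x.
have x0 : 0 < x by near: x; exact: nbhs_pinfty_gt.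
(* The bound [(lambda * (x + se2))^-1] is at most [e] exactly when [(lambda * e)^-1 <= x + se2]. *)
have xe : (lambda * e)^-1 <= x by near: x; exact: (nbhs_pinfty_ge (num_real _)).
rewrite sub0r normrN ger0_norm ?rho_star_ge0//.
apply: (le_trans (rho_star_le (ltW x0))).
have xse2 : 0 < x + se2 by exact: addr_gt0.
rewrite invf_ple ?posrE ?mulr_gt0// mulrC -ler_pdivrMr// -invfM mulrC.
by rewrite (le_trans xe)// lerDl ltW.
Unshelve. all: by end_near. Qed.

End rho_star_bounds.

Theorem corollary2 (R : realType) (d : measure_display) (T : measurableType d)
    (Pr : probability T R) (h : T -> R[i]) (P sn2 se2 xi lambda : R)
    (hP : 0 < P) (hsn2 : 0 < sn2) (hse2 : 0 < se2 < 1) (hxi : 0 < xi < 1)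
    (hgauss : complex_gaussian Pr h)
    (hcirc : circularly_symmetric Pr h)
    (hmean : zero_mean Pr h)
    (hvar : ('E_Pr[fun w => sqmod (h w)] = (1 - se2)%:E)%E)
    (hlambda : 0 < lambda < P / sn2)
    (hconstr : harvesting_constraint Pr h se2 xi (rho_star P sn2 se2 lambda))
    (hopt : optimal_policy Pr h P sn2 se2 xi (rho_star P sn2 se2 lambda)) :
  [/\ (exists2 x0 : R, 0 < x0 &
         forall x : R, 0 <= x < x0 -> rho_star P sn2 se2 lambda x = 0),
      rho_star P sn2 se2 lambda x @[x --> +oo] --> (0 : R) &
      ~ ({in `[0, +oo[ &, {homo rho_star P sn2 se2 lambda : x y / x <= y}} \/
         {in `[0, +oo[ &, {homo rho_star P sn2 se2 lambda : x y /~ x <= y}})].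
Proof.
case/andP: hse2 => s0 _; case/andP: hlambda => l0 la.
pose b := P / sn2 - lambda; have b0 : 0 < b by rewrite subr_gt0.
(* [x0] solves [x * b = se2 * lambda]: the policy is zero up to it and positive beyond. Its
   positivity rests on [lambda < P / sn2]. *)
pose x0 := se2 * lambda / b; have x0_gt0 : 0 < x0 by rewrite divr_gt0// mulr_gt0.
have small x : 0 <= x < x0 -> rho_star P sn2 se2 lambda x = 0.
  case/andP=> x_ge0; rewrite ltr_pdivlMr// => xx0.
  by apply/eqP; rewrite rho_star_eq0// ltW.
have cvg0 := rho_star_cvg0 hP hsn2 s0 l0.
split=> //; first by exists x0.
have x1_ge0 : 0 <= x0 + 1 by rewrite addr_ge0 ?ltW.
have rho_x1 : 0 < rho_star P sn2 se2 lambda (x0 + 1).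
  rewrite lt0r rho_star_ge0 andbT rho_star_eq0// -ler_pdivlMr//.
  by rewrite -ltNge ltrDl.
case=> mono.
  (* A nondecreasing policy could not fall below its positive value at [x0 + 1], yet its limit 0
     forces this at some [y] past that point. *)
  have : \forall x \near +oo,
      rho_star P sn2 se2 lambda x < rho_star P sn2 se2 lambda (x0 + 1).
    exact: (cvgr_lt 0).
  move=> /(filterI (nbhs_pinfty_ge (num_real (x0 + 1))))/filter_ex[y [x1y]].
  apply/negP; rewrite -leNgt; apply: mono => //.
    by rewrite in_itv/= x1_ge0.
  by rewrite in_itv/= (le_trans x1_ge0).
(* A nonincreasing policy would stay at most its value 0 at the origin. *)
have := mono (x0 + 1) 0; rewrite !in_itv/= lexx x1_ge0 (small 0) ?lexx//.
by rewrite leNgt rho_x1 => /(_ isT isT isT).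
Qed.
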